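(* Let $\alpha \colon \Gamma \curvearrowright A$ be an action of a discrete group $\Gamma$ on a unital $C^*$-algebra $A$. Then the inclusion $A \subseteq A \rtimes_r \Gamma$ has the relative Dixmier property if and only if $A$ has the Dixmier property and the action $\alpha$ has (SAveP).
   Context: For a unital $C^*$-algebra $A$ with unitary group $\mathcal{U}(A)$ and a $*$-automorphism $\beta$ on $A$, $\beta$ has the strong averaging property (SAveP) if for all $b \in A$, $0$ belongs to the norm closed convex hull of $\{v b \beta(v)^* : v \in \mathcal{U}(A)\}$. An action $\alpha$ of a discrete group $\Gamma$ on $A$ has (SAveP) if $\alpha_t$ has (SAveP) for all $t \in \Gamma$, $t \neq e$, where $e$ is the neutral element. $A \rtimes_r \Gamma$ is the reduced crossed product. For a unital inclusion $B \subseteq D$ of unital $C^*$-algebras and $x \in D$, let $C_B(x)$ be the norm closed convex hull of $\{v x v^* : v \in \mathcal{U}(B)\}$. A unital $C^*$-algebra $A$ has the Dixmier property if $C_A(x) \cap \mathbb{C} 1_A \neq \emptyset$ for all $x \in A$ (this is stricter than the definition requiring only that $C_A(x)$ meets the center of $A$). The inclusion $B \subseteq D$ has the relative Dixmier property if $C_B(x) \cap \mathbb{C} 1_D \neq \emptyset$ for all $x \in D$. *)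

(* Defs.v *)
From HB Require Import structures.
From mathcomp Require Import all_boot all_order all_algebra.
From mathcomp Require Import complex.
From mathcomp Require Import all_classical all_reals all_analysis.

Set Implicit Arguments.
Unset Strict Implicit.
Unset Printing Implicit Defensive.

Import Order.TTheory GRing.Theory Num.Theory.
Import numFieldNormedType.Exports.

Local Open Scope classical_set_scope.
Local Open Scope ring_scope.
Local Open Scope complex_scope.

(** * C*-algebras and Hilbert spaces *)

(* The multiplication is part of the mixin: HB rejects a join of the ring and
   normed-module structures declared downstream of [numDomainType], which already
   inherits from both. The zero algebra, with [cone = 0], is allowed. *)
HB.mixin Record isCStarAlgebra (R : realType) A
    of CompleteNormedModule R[i] A := {
  cone : A ;
  cmul : A -> A -> A ;
  star : A -> A ;
  cmulA : associative cmul ;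
  cmul1x : left_id cone cmul ;
  cmulx1 : right_id cone cmul ;
  cmulDl : left_distributive cmul +%R ;
  cmulDr : right_distributive cmul +%R ;
  cmulZl : forall (c : R[i]) (x y : A), cmul (c *: x) y = c *: cmul x y ;
  cmulZr : forall (c : R[i]) (x y : A), cmul x (c *: y) = c *: cmul x y ;
  starK : involutive star ;
  starD : {morph star : x y / x + y} ;
  starZ : forall (c : R[i]) (x : A), star (c *: x) = Num.conj c *: star x ;
  starM : forall x y : A, star (cmul x y) = cmul (star y) (star x) ;
  cstar_normM : forall x y : A, `|cmul x y| <= `|x| * `|y| ;
  cstar_normE : forall x : A, `|cmul (star x) x| = `|x| ^+ 2
}.

#[short(type="cstarAlgType")]
HB.structure Definition CStarAlgebra (R : realType) :=
  { A of isCStarAlgebra R A & CompleteNormedModule R[i] A }.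

Declare Scope cstar_scope.
Delimit Scope cstar_scope with cstar.
Bind Scope cstar_scope with CStarAlgebra.sort.
Notation "1" := cone : cstar_scope.
Notation "x * y" := (cmul x y) : cstar_scope.
Notation "x ^*" := (star x) : cstar_scope.

HB.mixin Record isHilbert (R : realType) H
    of CompleteNormedModule R[i] H := {
  inner : H -> H -> R[i] ;
  inner_linear : forall z : H, scalar (fun x => inner x z) ;
  innerC : forall x y : H, inner y x = Num.conj (inner x y) ;
  inner_norm : forall x : H, inner x x = `|x| ^+ 2
}.

#[short(type="hilbertType")]
HB.structure Definition Hilbert (R : realType) :=
  { H of isHilbert R H & CompleteNormedModule R[i] H }.

(* The norm of a [normedModType R[i]] is [R[i]]-valued. *)
Definition real_norm (R : realType) (V : normedModType R[i]) (x : V) : R :=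
  complex.Re `|x|.

(** * Morphisms, unitaries, actions and representations *)

Definition star_hom (R : realType) (A B : cstarAlgType R) (f : A -> B) : Prop :=
  [/\ linear f, f 1%cstar = 1%cstar,
      forall x y, f (x * y)%cstar = (f x * f y)%cstar
    & forall x, f (x^*)%cstar = ((f x)^*)%cstar].

Definition star_aut (R : realType) (A : cstarAlgType R) (f : A -> A) : Prop :=
  star_hom f /\ bijective f.

Definition unitaries (R : realType) (A : cstarAlgType R) : set A :=
  [set v | (v^* * v = 1 /\ v * v^* = 1)%cstar].

Definition cstar_action (R : realType) (G : groupType) (A : cstarAlgType R)
    (alpha : G -> A -> A) : Prop :=
  [/\ forall t, star_aut (alpha t),
      forall a, alpha 1%g a = a
    & forall s t a, alpha (s * t)%g a = alpha s (alpha t a)].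

Definition faithful_rep (R : realType) (A : cstarAlgType R) (H : hilbertType R)
    (rho : A -> H -> H) : Prop :=
  [/\ forall a, linear (rho a) /\ continuous (rho a),
      forall xi, linear (fun a => rho a xi),
      (forall xi, rho 1%cstar xi = xi) /\
      (forall a b xi, rho (a * b)%cstar xi = rho a (rho b xi)),
      forall a xi eta, inner (rho a xi) eta = inner xi (rho (a^*)%cstar eta)
    & injective rho].

(** * The reduced crossed product *)

(* [\sum_(t \in setT)] is the sum over the (finite) support. *)
Definition finitely_supported (G : choiceType) (V : nmodType) (f : G -> V) :
  Prop := finite_set [set t | f t != 0].

(* l^2(G, H) consists of the [xi] with [l2_norm xi < +oo]. *)
Definition l2_norm (R : realType) (G : choiceType) (H : hilbertType R)
    (xi : G -> H) : \bar R :=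
  sqrte (\esum_(s in [set: G]) ((real_norm (xi s)) ^+ 2)%:E).

(* The operator [\sum_t pi (f t) \o lambda t] on l^2(G, H), where
   [(pi a xi) s = rho (alpha s^-1 a) (xi s)] and
   [(lambda t xi) s = xi (t^-1 s)]. *)
Definition regular_rep (R : realType) (G : groupType) (A : cstarAlgType R)
    (H : hilbertType R) (alpha : G -> A -> A) (rho : A -> H -> H)
    (f : G -> A) (xi : G -> H) (s : G) : H :=
  \sum_(t \in [set: G]) rho (alpha (s^-1)%g (f t)) (xi (t^-1 * s)%g).

Definition reduced_norm (R : realType) (G : groupType) (A : cstarAlgType R)
    (H : hilbertType R) (alpha : G -> A -> A) (rho : A -> H -> H)
    (f : G -> A) : \bar R :=
  ereal_sup [set l2_norm (regular_rep alpha rho f xi)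
            | xi in [set xi : G -> H | (l2_norm xi <= 1)%E]].

(* [D] is the completion of the *-algebra C_c(G, A) of finitely supported
   functions in the norm of the regular representation induced by a faithful
   representation of [A]. The covariant pair [(iota, u)] describes the canonical
   map [f |-> \sum_t iota (f t) * u t] from C_c(G, A) to [D]. *)
Definition is_reduced_crossed_product (R : realType) (G : groupType)
    (A : cstarAlgType R) (alpha : G -> A -> A)
    (D : cstarAlgType R) (iota : A -> D) (u : G -> D) : Prop :=
  let incl (f : G -> A) : D := \sum_(t \in [set: G]) (iota (f t) * u t)%cstar in
  [/\ star_hom iota,
      (forall t, unitaries (u t)) /\ (forall s t, u (s * t)%g = (u s * u t)%cstar),
      forall t a, (u t * iota a * (u t)^*)%cstar = iota (alpha t a),
      (exists (H : hilbertType R) (rho : A -> H -> H), faithful_rep rho /\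
        forall f, finitely_supported f ->
          (real_norm (incl f))%:E = reduced_norm alpha rho f)
    & dense [set incl f | f in [set f | finitely_supported f]]].

(** * Averaging properties *)

Definition convex_hull (R : realType) (V : lmodType R[i]) (S : set V) : set V :=
  [set x | exists (n : nat) (c : 'I_n -> R) (y : 'I_n -> V),
     [/\ forall k, 0 <= c k, \sum_(k < n) c k = 1, forall k, S (y k)
       & x = \sum_(k < n) (c k)%:C *: y k]].

(* C_B(x) for the inclusion [iota : B -> D]; recall that the unitaries of
   [range iota] are the images of those of [B] when [iota] is injective. *)
Definition avg_hull (R : realType) (B D : cstarAlgType R) (iota : B -> D)
    (x : D) : set D :=
  closure (convex_hull
    [set (iota v * x * (iota v)^*)%cstar | v in @unitaries R B]).

Definition scalars (R : realType) (D : cstarAlgType R) : set D :=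
  range (fun c : R[i] => c *: (1%cstar : D)).

Definition relative_dixmier (R : realType) (B D : cstarAlgType R)
    (iota : B -> D) : Prop :=
  forall x : D, avg_hull iota x `&` @scalars R D !=set0.

Definition dixmier (R : realType) (A : cstarAlgType R) : Prop :=
  forall x : A, avg_hull id x `&` @scalars R A !=set0.

Definition savep (R : realType) (A : cstarAlgType R) (beta : A -> A) : Prop :=
  forall b : A,
    closure (convex_hull
      [set (v * b * (beta v)^*)%cstar | v in @unitaries R A]) 0.

Definition action_savep (R : realType) (G : groupType) (A : cstarAlgType R)
    (alpha : G -> A -> A) : Prop :=
  forall t : G, t <> 1%g -> savep (alpha t).

(* Main.v *)
Require Import Defs.
From HB Require Import structures.
From mathcomp Require Import all_boot all_order all_algebra.
From mathcomp Require Import complex lra.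
From mathcomp Require Import all_classical all_reals all_analysis.

Set Implicit Arguments.
Unset Strict Implicit.
Unset Printing Implicit Defensive.

Import Order.TTheory GRing.Theory Num.Theory.
Import numFieldNormedType.Exports.

Local Open Scope classical_set_scope.
Local Open Scope ring_scope.
Local Open Scope complex_scope.

(** Three facts carry the proof. They concern the averages [\sum_k c_k v_k x w_k^*], where
[v_k] and [w_k] are the images of one unitary of [A] under two homomorphisms.

Averaging does not increase the norm, and averages compose. Hence finitely many
smallness conditions can be reached one after the other, since a later average does
not spoil an earlier estimate ([average_small]).

The coefficients of the crossed product are controlled by the norm:
[|f t| <= |\sum_s iota (f s) u_s|] ([crossed_coefficient_le]). Testing the regular
representation on vectors supported at one point of the group bounds every
[rho (alpha s^-1 (f t))] by the norm of the sum; as [iota (f t)] acts diagonally with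
these blocks, its norm is bounded too, and [iota] is isometric.

Averaging by unitaries of [A] respects the coefficients: it turns [iota b u_t] into
[iota b' u_t], where [b'] is the average of [b] twisted by [alpha t]
([average_crossed]).

Suppose that the inclusion has the relative Dixmier property. Averages of [iota a]
close to a scalar are images of averages of [a], and [iota] is isometric, so [A] has
the Dixmier property. If averages [iota b' u_t] of [iota b u_t] are close to a scalar
[c] and [t] is not neutral, then [b'] is a coefficient of [iota b' u_t - c], hence
small: this is the strong averaging property of [alpha t].

Conversely let [x] be in the crossed product, let [a] be its conditional expectation
on [A] ([expectation_exists]) and let the scalar [c] be a limit of averages of [a].
Approximate [x] by a finite sum. A first average brings its coefficient at the
neutral element close to [c]; the strong averaging property then makes the
remaining coefficients small, while the first estimate persists because [c] is fixed
by averaging. As [c] depends on [a] only, one scalar serves all approximations of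
[x], so [c] is a limit of averages of [x].

That an injective *-homomorphism is isometric ([injective_star_hom_isometric]) is
proved without spectral theory. The iteration [y := (x + y^2) / 2] converges for every
[x] of norm at most 1 and yields a square root [1 - y] of [1 - x]; so a self-adjoint
contraction [h] is the real part of the unitary [h + i sqrt(1 - h^2)]. Membership of
the unit ball is then an algebraic matter which homomorphisms preserve, and which
injective ones reflect. *)

(** * The real-valued norm *)

Section RealNorm.
Variables (R : realType) (V : normedModType R[i]).
Implicit Types x y : V.
Local Notation N := (@real_norm R V).

Lemma real_normE x : `|x| = (N x)%:C.
Proof. by rewrite /real_norm RRe_real // normr_real. Qed.

Lemma real_norm_ge0 x : 0 <= N x.
Proof. by rewrite -lecR -real_normE normr_ge0. Qed.

Lemma real_norm0 : N 0 = 0.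
Proof. by rewrite /real_norm normr0. Qed.

Lemma real_norm_eq0 x : N x = 0 -> x = 0.
Proof. by move=> x0; apply/eqP; rewrite -normr_eq0 real_normE x0. Qed.

Lemma real_normN x : N (- x) = N x.
Proof. by rewrite /real_norm normrN. Qed.

Lemma real_normB x y : N (x - y) = N (y - x).
Proof. by rewrite -real_normN opprB. Qed.

Lemma real_normD x y : N (x + y) <= N x + N y.
Proof. by rewrite -lecR rmorphD /= -!real_normE ler_normD. Qed.

Lemma real_norm_triangle y x z : N (x - z) <= N (x - y) + N (y - z).
Proof. by rewrite -[x - z](subrKA y) real_normD. Qed.

Lemma real_normZ (c : R[i]) x : N (c *: x) = complex.Re `|c| * N x.
Proof.
by rewrite {1}/real_norm normrZ real_normE -[`|c|]RRe_real ?normr_real //= mulr0 subr0.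
Qed.

Lemma real_normZr (c : R) x : N (c%:C *: x) = `|c| * N x.
Proof. by rewrite real_normZ normc_def /= expr0n addr0 sqrtr_sqr. Qed.

Lemma real_norm_sum (I : Type) (r : seq I) (F : I -> V) :
  N (\sum_(i <- r) F i) <= \sum_(i <- r) N (F i).
Proof.
elim: r => [|i r IH]; first by rewrite !big_nil real_norm0.
by rewrite !big_cons (le_trans (real_normD _ _)) // lerD2l.
Qed.

Lemma ball_real_norm x y (e : R) : ball x e%:C y <-> N (x - y) < e.
Proof. by rewrite -ball_normE /ball_ /= real_normE ltcR. Qed.

Lemma pos_complexE (e : R[i]) : 0 < e -> exists2 d : R, 0 < d & e = d%:C.
Proof.
by move=> e0; exists (complex.Re e); rewrite -?ltcR RRe_real ?gtr0_real.
Qed.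

Lemma closure_real_norm (S : set V) x :
  closure S x <-> forall e : R, 0 < e -> exists2 y, S y & N (x - y) < e.
Proof.
split=> [Sx e e0|Sx B /nbhs_ballP[e /= /pos_complexE[d d0 ->] dB]].
  have [|y [Sy /ball_real_norm xy]] := Sx (ball x e%:C).
    by apply: nbhsx_ballx; rewrite ltcR.
  by exists y.
have [y Sy xy] := Sx d d0.
by exists y; split=> //; apply/dB/ball_real_norm.
Qed.

Lemma dense_real_norm (S : set V) x (e : R) :
  dense S -> 0 < e -> exists2 y, S y & N (x - y) < e.
Proof.
move=> dS e0; have ec : 0 < e%:C :> R[i] by rewrite ltcR.
have [||y [/ball_real_norm xy Sy]] := dS (ball x e%:C).
- by exists x; exact: ballxx.
- exact: ball_open.
by exists y.
Qed.

End RealNorm.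

Definition norm_cvg (R : realType) (V : normedModType R[i]) (a : nat -> V) (l : V) :
    Prop :=
  forall e : R, 0 < e -> exists n0, forall n, (n0 <= n)%N -> real_norm (a n - l) < e.

Lemma real_norm_cauchy (R : realType) (V : completeNormedModType R[i])
    (a : nat -> V) :
  (forall e : R, 0 < e -> exists n0, forall m n, (n0 <= m)%N -> (n0 <= n)%N ->
     real_norm (a m - a n) < e) ->
  exists l, norm_cvg a l.
Proof.
move=> aC.
have /cauchy_cvg aL : cauchy (a @ \oo).
  apply: cauchy_exP => e /= /pos_complexE[d d0 ->].
  have [n0 dn0] := aC d d0; exists (a n0).
  by exists n0 => // n /= n0n; apply/ball_real_norm; apply: dn0.
exists (lim (a @ \oo)) => e e0.
have /= [] := aL (ball (lim (a @ \oo)) e%:C) (nbhsx_ballx _ _ _).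
  by rewrite ltcR.
move=> n0 _ n0e; exists n0 => n /n0e /= /ball_real_norm.
by rewrite real_normB.
Qed.

Lemma real_norm_lim_unique (R : realType) (V : normedModType R[i]) (x y : V) :
  (forall e : R, 0 < e -> real_norm (x - y) <= e) -> x = y.
Proof.
move=> xy; apply/eqP; rewrite -subr_eq0; apply/eqP/real_norm_eq0/eqP.
by rewrite eq_le real_norm_ge0 andbT; apply/ler_addgt0Pl => e /xy; rewrite addr0.
Qed.

Section NormCvg.
Variable R : realType.

Lemma norm_cvg_lipschitz (V W : normedModType R[i]) (C : R) (a : nat -> V) (l : V)
    (b : nat -> W) (m : W) :
  (forall n, real_norm (b n - m) <= C * real_norm (a n - l)) ->
  norm_cvg a l -> norm_cvg b m.
Proof.
move=> ba al e e0; have C0 : 0 < `|C| + 1 by rewrite ltr_wpDl.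
have [|n0 Hn] := al (e / (`|C| + 1)); first by rewrite divr_gt0.
exists n0 => n /Hn; rewrite ltr_pdivlMr// => He.
rewrite (le_lt_trans (ba n))// (le_lt_trans _ He)// mulrC ler_wpM2l ?real_norm_ge0//.
by rewrite (le_trans (ler_norm _))// lerDl.
Qed.

Lemma norm_cvg_unique (V : normedModType R[i]) (a : nat -> V) (l m : V) :
  norm_cvg a l -> norm_cvg a m -> l = m.
Proof.
move=> al am; apply: real_norm_lim_unique => e e0.
have e2 : 0 < e / 2 by rewrite divr_gt0.
have [n1 H1] := al _ e2; have [n2 H2] := am _ e2.
have := H1 _ (leq_maxl n1 n2); have := H2 _ (leq_maxr n1 n2).
set n := maxn _ _ => h2 h1.
have := real_norm_triangle (a n) l m; rewrite (real_normB l (a n)) => h3; lra.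
Qed.

Lemma norm_cvg_le (V : normedModType R[i]) (a : nat -> V) (l : V) (c : R) :
  norm_cvg a l -> (forall n, real_norm (a n) <= c) -> real_norm l <= c.
Proof.
move=> al ac; apply/ler_addgt0Pr => e /al[n Hn].
have := ac n; have := Hn n (leqnn n).
have := real_norm_triangle (a n) l 0; rewrite !subr0 (real_normB l) => *; lra.
Qed.

End NormCvg.

(** * Elementary facts on C*-algebras *)

Section CStarBasics.
Variables (R : realType) (A : cstarAlgType R).
Implicit Types x y v : A.
Local Notation N := (@real_norm R A).

Lemma cmulNx x y : ((- x) * y)%cstar = - (x * y)%cstar.
Proof. by rewrite -scaleN1r cmulZl scaleN1r. Qed.

Lemma cmulxN x y : (x * (- y))%cstar = - (x * y)%cstar.
Proof. by rewrite -scaleN1r cmulZr scaleN1r. Qed.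

Lemma cmul0x x : (0 * x)%cstar = 0 :> A.
Proof. by apply: (addrI (0 * x)%cstar); rewrite -cmulDl !addr0. Qed.

Lemma cmulx0 x : (x * 0)%cstar = 0 :> A.
Proof. by apply: (addrI (x * 0)%cstar); rewrite -cmulDr !addr0. Qed.

Lemma cmulBl x y z : ((x - y) * z)%cstar = (x * z)%cstar - (y * z)%cstar.
Proof. by rewrite cmulDl cmulNx. Qed.

Lemma cmulBr x y z : (z * (x - y))%cstar = (z * x)%cstar - (z * y)%cstar.
Proof. by rewrite cmulDr cmulxN. Qed.

Lemma star1 : (1^*)%cstar = 1%cstar :> A.
Proof.
have /esym := starM (1%cstar : A) (1^*)%cstar.
by rewrite cmul1x starK cmul1x.
Qed.

Lemma star0 : (0^*)%cstar = 0 :> A.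
Proof. by apply: (addrI (0^*)%cstar); rewrite -starD !addr0. Qed.

Lemma starN x : ((- x)^*)%cstar = - (x^*)%cstar.
Proof. by rewrite -scaleN1r starZ rmorphN rmorph1 scaleN1r. Qed.

Lemma starB x y : ((x - y)^*)%cstar = (x^*)%cstar - (y^*)%cstar.
Proof. by rewrite starD starN. Qed.

Lemma starZr (c : R) x : ((c%:C *: x)^*)%cstar = c%:C *: (x^*)%cstar.
Proof. by rewrite starZ (CrealP _) // complex_real. Qed.

Lemma real_normM x y : N (x * y)%cstar <= N x * N y.
Proof. by rewrite -lecR rmorphM /= -!real_normE cstar_normM. Qed.

Lemma real_norm_cstar x : N (x^* * x)%cstar = N x ^+ 2.
Proof. by apply: (@complexI R); rewrite rmorphXn /= -!real_normE cstar_normE. Qed.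

Lemma real_norm_star x : N (x^*)%cstar = N x.
Proof.
have le_star y : N y <= N (y^*)%cstar.
  have [->|y0] := eqVneq (N y) 0; first exact: real_norm_ge0.
  have yp : 0 < N y by rewrite lt_neqAle eq_sym y0 real_norm_ge0.
  by rewrite -(ler_pM2r yp) -expr2 -real_norm_cstar real_normM.
by apply/eqP; rewrite eq_le le_star -{2}[x]starK le_star.
Qed.

Lemma sqr_le1 (r : R) : 0 <= r -> r ^+ 2 <= r -> r <= 1.
Proof. by move=> r0 rr; nra. Qed.

(** The norm of the unit is 0 in the zero algebra and 1 in any other. *)
Lemma real_norm1_le1 : N 1%cstar <= 1.
Proof.
by apply: sqr_le1; rewrite ?real_norm_ge0// -real_norm_cstar star1 cmul1x.
Qed.

Lemma unitary_norm v : unitaries v -> N v <= 1.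
Proof.
move=> [vv _]; rewrite -(@expr_le1 _ 2) ?real_norm_ge0//.
by rewrite -real_norm_cstar vv real_norm1_le1.
Qed.

Lemma unitary1 : unitaries (1%cstar : A).
Proof. by split; rewrite star1 cmul1x. Qed.

Lemma unitaryM v w : unitaries v -> unitaries w -> unitaries (v * w : A)%cstar.
Proof.
move=> [v1 v2] [w1 w2]; split; rewrite starM.
  by rewrite -cmulA (cmulA v^*%cstar) v1 cmul1x.
by rewrite -cmulA (cmulA w) w2 cmul1x.
Qed.

Lemma unitary_star v : unitaries v -> unitaries (v^* : A)%cstar.
Proof. by move=> [v1 v2]; split; rewrite starK. Qed.

Lemma real_norm_conj_le v w x : unitaries v -> unitaries w ->
  N (v * x * w)%cstar <= N x.
Proof.
move=> /unitary_norm v1 /unitary_norm w1.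
rewrite (le_trans (real_normM _ _))// (le_trans (ler_piMr _ w1)) ?real_norm_ge0//.
by rewrite (le_trans (real_normM _ _))// ler_piMl// real_norm_ge0.
Qed.

(** The way in which order enters without any spectral theory: a self-adjoint
contraction is the real part of a unitary. *)
Lemma selfadj_unitary (h y : A) : (h^* = h)%cstar -> (y^* = y)%cstar ->
  (h * y = y * h)%cstar -> (h * h)%cstar + (y * y)%cstar = 1%cstar ->
  unitaries (h + 'i *: y).
Proof.
move=> hs ys hy hhyy; split; rewrite starD starZ hs ys conjCi scaleNr.
  rewrite cmulBl !cmulDr cmulZl !cmulZr cmulZl scalerA -expr2 sqrCi scaleN1r.
  by rewrite hy opprB addrACA subrr addr0.
rewrite cmulDl !cmulBr !cmulZl !cmulZr scalerA -expr2 sqrCi scaleN1r.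
by rewrite opprK hy addrA subrK.
Qed.

Lemma norm_re_unitary (h y : A) : (h^* = h)%cstar -> (y^* = y)%cstar ->
  unitaries (h + 'i *: y) -> N h <= 1.
Proof.
move=> hs ys /unitary_norm u1.
have h2 : h + 'i *: y + (h + 'i *: y)^*%cstar = 2%:C *: h.
  rewrite starD starZ hs ys conjCi scaleNr addrACA subrr addr0.
  by rewrite rmorphD rmorph1 scalerDl scale1r.
have := real_normD (h + 'i *: y) (h + 'i *: y)^*%cstar.
rewrite h2 real_norm_star real_normZr ger0_norm//.
by move=> le2; lra.
Qed.

Lemma norm_im_unitary (h y : A) : (h^* = h)%cstar -> (y^* = y)%cstar ->
  unitaries (h + 'i *: y) -> N y <= 1.
Proof.
move=> hs ys /unitary_norm u1.
have y2 : h + 'i *: y - (h + 'i *: y)^*%cstar = 'i *: (2%:C *: y).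
  rewrite starD starZ hs ys conjCi scaleNr opprD opprK addrACA subrr add0r.
  by rewrite rmorphD rmorph1 scalerDl scale1r scalerDr.
have := real_normD (h + 'i *: y) (- (h + 'i *: y)^*%cstar).
rewrite y2 real_normN real_norm_star real_normZ normCi real_normZr ger0_norm//=.
by move=> le2; lra.
Qed.

End CStarBasics.

Section StarHom.
Variables (R : realType) (A B : cstarAlgType R) (f : A -> B).
Hypothesis f_hom : star_hom f.

Lemma star_homD : {morph f : x y / x + y}.
Proof. by case: f_hom => lf _ _ _ x y; have := lf 1 x y; rewrite !scale1r. Qed.

Lemma star_hom0 : f 0 = 0.
Proof. by apply: (addrI (f 0)); rewrite -star_homD !addr0. Qed.

Lemma star_homZ (c : R[i]) x : f (c *: x) = c *: f x.
Proof.
by case: f_hom => lf _ _ _; have := lf c x 0; rewrite star_hom0 !addr0.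
Qed.

Lemma star_homB : {morph f : x y / x - y}.
Proof. by move=> x y; rewrite star_homD -scaleN1r star_homZ scaleN1r. Qed.

Lemma star_hom1 : f 1%cstar = 1%cstar. Proof. by case: f_hom. Qed.

Lemma star_homM x y : f (x * y)%cstar = (f x * f y)%cstar.
Proof. by case: f_hom. Qed.

Lemma star_hom_star x : f (x^*)%cstar = ((f x)^*)%cstar.
Proof. by case: f_hom. Qed.

Lemma star_hom_unitary v : unitaries v -> unitaries (f v).
Proof.
by move=> [v1 v2]; split; rewrite -star_hom_star -star_homM ?v1 ?v2 star_hom1.
Qed.

Lemma star_hom_sum (I : Type) (r : seq I) (F : I -> A) :
  f (\sum_(i <- r) F i) = \sum_(i <- r) f (F i).
Proof. by apply: (big_morph f star_homD star_hom0). Qed.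

End StarHom.

Lemma star_hom_id (R : realType) (A : cstarAlgType R) : star_hom (@id A).
Proof. by split. Qed.

(** * Square roots near the unit *)

Section SquareRoot.
Variable R : realType.

(** Fixed points [y] of the step satisfy [(1 - y)^2 = 1 - x]. *)
Fixpoint sqrt_iter (A : cstarAlgType R) (x : A) (n : nat) : A :=
  if n is n'.+1 then
    (2^-1)%:C *: (x + (sqrt_iter x n' * sqrt_iter x n')%cstar)
  else 0.

(** The same iteration for the number 1. It dominates [sqrt_iter x] and the increments
of [sqrt_iter x] as soon as [x] has norm at most 1, boundary included, where the step
is no longer a contraction. *)
Fixpoint sqrt_bound (n : nat) : R :=
  if n is n'.+1 then 2^-1 * (1 + sqrt_bound n' ^+ 2) else 0.

Lemma sqrt_bound_itv n : 0 <= sqrt_bound n <= 1.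
Proof.
elim: n => [|n /andP[b0 b1]] /=; first by rewrite lexx ler01.
by apply/andP; split; nra.
Qed.

Lemma sqrt_bound_cauchy (e : R) : 0 < e ->
  exists n0, forall n, (n0 <= n)%N -> sqrt_bound n - sqrt_bound n0 < e.
Proof.
move=> e0; pose S := range sqrt_bound.
have supS : has_sup S.
  split; first by exists 0, 0%N.
  by exists 1 => _ [n _ <-]; case/andP: (sqrt_bound_itv n).
have [_ [n0 _ <-] Hn0] := sup_adherent e0 supS.
exists n0 => n _; have : sqrt_bound n <= sup S by apply: sup_upper_bound => //; exists n.
by move=> ?; lra.
Qed.

Variable A : cstarAlgType R.
Implicit Types x y z : A.
Local Notation N := (@real_norm R A).

Lemma norm_sub_squares y z :
  N ((y * y)%cstar - (z * z)%cstar) <= (N y + N z) * N (y - z).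
Proof.
have -> : (y * y)%cstar - (z * z)%cstar = (y * (y - z))%cstar + ((y - z) * z)%cstar.
  by rewrite cmulBr cmulBl addrA subrK.
rewrite (le_trans (real_normD _ _))// mulrDl lerD// ?real_normM//.
by rewrite mulrC real_normM.
Qed.

Lemma sqrt_iter_norm x n : N x <= 1 -> N (sqrt_iter x n) <= sqrt_bound n.
Proof.
move=> x1; elim: n => [|n IH] /=; first by rewrite real_norm0.
rewrite real_normZr ger0_norm// ler_pM2l//.
rewrite (le_trans (real_normD _ _))// lerD// (le_trans (real_normM _ _))//.
by rewrite -expr2 lerXn2r ?nnegrE ?real_norm_ge0//; case/andP: (sqrt_bound_itv n).
Qed.

(** From [y^2 - z^2 = y (y - z) + (y - z) z], which bounds the step by the factors of
[a^2 - b^2] for the dominating numbers. *)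
Lemma sqrt_iter_step x n : N x <= 1 ->
  N (sqrt_iter x n.+1 - sqrt_iter x n) <= sqrt_bound n.+1 - sqrt_bound n.
Proof.
move=> x1; elim: n => [|n IH].
  by rewrite /= cmul0x addr0 !subr0 real_normZr ger0_norm// expr0n addr0 ler_pM2l.
rewrite [in X in X <= _]/= -/(sqrt_iter x n.+1) -scalerBr opprD addrACA subrr add0r.
rewrite real_normZr ger0_norm//.
apply: (@le_trans _ _ (2^-1 * ((sqrt_bound n.+1 + sqrt_bound n) *
   (sqrt_bound n.+1 - sqrt_bound n)))); last by rewrite /=; lra.
rewrite ler_pM2l// (le_trans (norm_sub_squares _ _))//.
by rewrite ler_pM ?addr_ge0 ?real_norm_ge0// lerD// sqrt_iter_norm.
Qed.

Lemma sqrt_iter_diff x m n : N x <= 1 -> (m <= n)%N ->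
  N (sqrt_iter x n - sqrt_iter x m) <= sqrt_bound n - sqrt_bound m.
Proof.
move=> x1 /subnKC <-; elim: (n - m)%N => [|k IH].
  by rewrite addn0 !subrr real_norm0.
rewrite addnS.
have := real_norm_triangle (sqrt_iter x (m + k))
  (sqrt_iter x (m + k).+1) (sqrt_iter x m).
by have := sqrt_iter_step (m + k) x1 => *; lra.
Qed.

Lemma sqrt_iter_cvg x : N x <= 1 -> exists y, norm_cvg (sqrt_iter x) y.
Proof.
move=> x1; apply: real_norm_cauchy => e e0.
have [|n0 Hn0] := @sqrt_bound_cauchy (e / 2); first by rewrite divr_gt0.
exists n0 => m n n0m n0n.
have := real_norm_triangle (sqrt_iter x n0) (sqrt_iter x m) (sqrt_iter x n).
rewrite (real_normB (sqrt_iter x n0)).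
have := sqrt_iter_diff x1 n0m; have := sqrt_iter_diff x1 n0n.
by have := Hn0 _ n0m; have := Hn0 _ n0n => *; lra.
Qed.

Lemma sqrt_fixpoint_exists x : N x <= 1 -> exists y,
  [/\ N y <= 1, y = (2^-1)%:C *: (x + (y * y)%cstar),
      (x^* = x -> y^* = y)%cstar
    & forall z, (z * x = x * z)%cstar -> (z * y = y * z)%cstar].
Proof.
move=> x1; have [y xy] := sqrt_iter_cvg x1; exists y.
have le1 n : N (sqrt_iter x n) <= 1.
  by rewrite (le_trans (sqrt_iter_norm n x1))//; case/andP: (sqrt_bound_itv n).
have y1 : N y <= 1 by exact: norm_cvg_le xy le1.
split=> //.
- apply: (@norm_cvg_unique _ _ (fun n => sqrt_iter x n.+1)).
    by move=> e /xy[n0 Hn0]; exists n0 => n n0n; apply: Hn0; exact: leqW.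
  apply: (@norm_cvg_lipschitz _ _ _ 1 _ _ _ _ _ xy) => n /=.
  rewrite -scalerBr opprD addrACA subrr add0r real_normZr ger0_norm//.
  rewrite ler_pdivrMl// mulrA (le_trans (norm_sub_squares _ _))//.
  by rewrite ler_wpM2r ?real_norm_ge0// mulr1 (lerD (le1 n) y1).
- move=> xs; apply: (norm_cvg_unique _ xy).
  have si n : ((sqrt_iter x n)^*)%cstar = sqrt_iter x n.
    by elim: n => [|n IH] /=; rewrite ?star0 // starZr starD starM IH xs.
  apply: (@norm_cvg_lipschitz _ _ _ 1 _ _ _ _ _ xy) => n.
  by rewrite mul1r -{1}si -starB real_norm_star.
- move=> z zx; apply: (@norm_cvg_unique _ _ (fun n => z * sqrt_iter x n)%cstar).
    apply: (@norm_cvg_lipschitz _ _ _ (N z) _ _ _ _ _ xy) => n.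
    by rewrite -cmulBr real_normM.
  have zi n : (z * sqrt_iter x n = sqrt_iter x n * z)%cstar.
    elim: n => [|n IH] /=; first by rewrite cmul0x cmulx0.
    by rewrite cmulZr cmulZl cmulDr cmulDl zx cmulA IH -cmulA IH cmulA.
  apply: (@norm_cvg_lipschitz _ _ _ (N z) _ _ _ _ _ xy) => n.
  by rewrite zi -cmulBl mulrC real_normM.
Qed.

(** This identifies the limit of the iteration with an explicit element in
[injective_star_hom_norm_le1]. It holds because
[2 |y - z| = |y^2 - z^2| <= (|y| + |z|) |y - z|] and [|y| + |z| < 2]. *)
Lemma sqrt_fixpoint_unique x y z : N y <= 1 -> N z < 1 ->
  y = (2^-1)%:C *: (x + (y * y)%cstar) ->
  z = (2^-1)%:C *: (x + (z * z)%cstar) -> y = z.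
Proof.
move=> y1 z1 ye ze; have := norm_sub_squares y z.
have -> : (y * y)%cstar - (z * z)%cstar = 2%:C *: (y - z).
  rewrite {3}ye {3}ze -scalerBr scalerA -rmorphM /= mulfV// scale1r.
  by rewrite opprD addrACA subrr add0r.
rewrite real_normZr ger0_norm// => h; apply/eqP; rewrite -subr_eq0.
by apply/eqP/real_norm_eq0; have := real_norm_ge0 (y - z); nra.
Qed.

Lemma sqr_one_sub_fixpoint x y : y = (2^-1)%:C *: (x + (y * y)%cstar) <->
  (((cone : A) - y) * ((cone : A) - y))%cstar = 1%cstar - x.
Proof.
have -> : (((cone : A) - y) * ((cone : A) - y))%cstar = 1%cstar - (2%:C *: y - (y * y)%cstar).
  rewrite cmulBl !cmulBr cmul1x cmul1x cmulx1 rmorphD rmorph1 scalerDl scale1r.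
  by rewrite -addrA -opprD -addrA.
split=> [/(congr1 ( *:%R 2%:C))|/addrI/oppr_inj <-].
  by rewrite scalerA -rmorphM /= mulfV// scale1r => ->; rewrite addrK.
by rewrite subrK scalerA -rmorphM /= mulVf// scale1r.
Qed.

Lemma sqrt_near_one x : N x <= 1 -> (x^* = x)%cstar -> exists w,
  [/\ (w * w)%cstar = 1%cstar - x, (w^* = w)%cstar
    & forall z, (z * x = x * z)%cstar -> (z * w = w * z)%cstar].
Proof.
move=> x1 xs; have [y [y1 /sqr_one_sub_fixpoint ye ys yz]] := sqrt_fixpoint_exists x1.
exists (1%cstar - y); split=> // [|z /yz zy].
  by rewrite starB star1 ys.
by rewrite cmulBl cmulBr cmulx1 cmul1x zy.
Qed.

End SquareRoot.

(** * Homomorphisms and norms *)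

Section Contractions.
Variables (R : realType) (A : cstarAlgType R).
Implicit Types h m : A.
Local Notation N := (@real_norm R A).

Lemma norm_sqr_le1 h : N h <= 1 -> N (h * h)%cstar <= 1.
Proof.
by move=> h1; rewrite (le_trans (real_normM _ _))// mulr_ile1 ?real_norm_ge0.
Qed.

Lemma sqr_selfadj h : (h^* = h)%cstar -> ((h * h)^* = h * h)%cstar.
Proof. by move=> hs; rewrite starM hs. Qed.

Lemma contraction_unitary h : (h^* = h)%cstar -> N h <= 1 -> exists w : A,
  [/\ (w^* = w)%cstar, (w * w)%cstar = 1%cstar - (h * h)%cstar
    & unitaries (h + 'i *: w)].
Proof.
move=> hs h1.
have [w [ww ws wz]] := sqrt_near_one (norm_sqr_le1 h1) (sqr_selfadj hs).
exists w; split=> //; apply: selfadj_unitary => //; last by rewrite ww addrC subrK.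
by apply: wz; rewrite cmulA.
Qed.

(** [1 - h^2] is the square of the imaginary part of a unitary. *)
Lemma norm_one_sub_sqr_le1 h : (h^* = h)%cstar -> N h <= 1 ->
  N (1%cstar - (h * h)%cstar) <= 1.
Proof.
move=> hs h1; have [w [ws <- hw]] := contraction_unitary hs h1.
by apply: norm_sqr_le1; exact: norm_im_unitary hw.
Qed.

End Contractions.

Section StarHomNorm.
Variables (R : realType) (A B : cstarAlgType R) (f : A -> B).
Hypothesis f_hom : star_hom f.

(** A homomorphism maps the unitary that completes [h] to one that completes [f h]. *)
Lemma star_hom_norm_le1 (h : A) : (h^* = h)%cstar -> real_norm h <= 1 ->
  real_norm (f h) <= 1.
Proof.
move=> hs h1; have [w [ws _ /(star_hom_unitary f_hom)]] := contraction_unitary hs h1.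
rewrite (star_homD f_hom) (star_homZ f_hom).
by apply: norm_re_unitary; rewrite -(star_hom_star f_hom) ?hs ?ws.
Qed.

Lemma star_hom_contractive (a : A) : real_norm (f a) <= real_norm a.
Proof.
have [a0|a0] := eqVneq (real_norm a) 0.
  by rewrite (real_norm_eq0 a0) (star_hom0 f_hom) !real_norm0.
have ap : 0 < real_norm a ^+ 2 by rewrite exprn_gt0// lt_neqAle eq_sym a0 real_norm_ge0.
have := @star_hom_norm_le1 ((real_norm a ^- 2)%:C *: (a^* * a)%cstar).
rewrite starZr starM starK real_normZr (star_homZ f_hom) real_normZr.
rewrite (star_homM f_hom) (star_hom_star f_hom) !real_norm_cstar.
have iv : 0 <= real_norm a ^- 2 by rewrite invr_ge0 ltW.
rewrite (ger0_norm iv) mulVf ?gt_eqF// => /(_ erefl (lexx _)).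
by rewrite ler_pdivrMl// mulr1 ler_sqr ?nnegrE ?real_norm_ge0.
Qed.

Hypothesis f_inj : injective f.

(** Let [m] be a small multiple of [1 - h * h]. In the codomain [1 - f m] has
norm less than 1, so [f m] is the positive square root of [f m * f m]; by
injectivity [m] is the root of [m * m] given by the same iteration in the domain.
This forces [1 - m] to be a contraction, so [m] is a square and [h] completes to
a unitary. *)
Lemma injective_star_hom_norm_le1 (h : A) : (h^* = h)%cstar ->
  real_norm (f h) < 1 -> real_norm h <= 1.
Proof.
move=> hs fh1.
(* The factor [s] makes [m] below a contraction. *)
pose s := (1 + real_norm h ^+ 2)^-1.
have d0 : 0 < 1 + real_norm h ^+ 2 by rewrite ltr_wpDr ?sqr_ge0.
have s0 : 0 < s by rewrite invr_gt0.
have s1 : s <= 1 by rewrite invf_le1// lerDl sqr_ge0.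
pose m := s%:C *: (1%cstar - (h * h)%cstar).
have ms : (m^* = m)%cstar by rewrite starZr starB star1 (sqr_selfadj hs).
have m1 : real_norm m <= 1.
  rewrite real_normZr (ger0_norm (ltW s0)) mulrC -ler_pdivlMr// mul1r invrK.
  rewrite (le_trans (real_normD _ _))// real_normN lerD ?real_norm1_le1//.
  exact: real_normM.
have [y [y1 ye _ _]] := sqrt_fixpoint_exists (norm_one_sub_sqr_le1 ms m1).
(* Both [f y] and [f (1 - m)] are fixed points of the iteration in the codomain. *)
have {ye} /f_inj ym : f y = f (1%cstar - m).
  apply: (@sqrt_fixpoint_unique _ _ (f (1%cstar - (m * m)%cstar))).
  - exact: le_trans (star_hom_contractive y) y1.
  - have -> : f (1%cstar - m) = (1 - s)%:C *: 1%cstar + s%:C *: (f h * f h)%cstar.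
      rewrite (star_homB f_hom) (star_homZ f_hom) (star_homB f_hom).
      rewrite (star_hom1 f_hom) (star_homM f_hom).
      by rewrite scalerBr opprB rmorphB scalerBl rmorph1 scale1r addrCA addrC.
    have s1' : 0 <= 1 - s by rewrite subr_ge0.
    rewrite (le_lt_trans (real_normD _ _))// !real_normZr (ger0_norm s1') (ger0_norm (ltW s0)).
    have := real_normM (f h) (f h); have := real_norm1_le1 B; have := real_norm_ge0 (f h).
    have := real_norm_ge0 (f h * f h)%cstar.
    set p := real_norm (f h * f h)%cstar; set q := real_norm 1%cstar.
    set r := real_norm (f h) => p0 r0 q1 pr.
    have : p < 1 by rewrite (le_lt_trans pr)// -expr2 expr_lt1.
    move=> p1; have sp : s * p < s by rewrite gtr_pMr.
    have sq : (1 - s) * q <= 1 - s by rewrite ler_piMr.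
    by rewrite -[ltRHS](subrK s) ler_ltD.
  - by rewrite -(star_homM f_hom) -(star_homD f_hom) -(star_homZ f_hom) -ye.
  - apply/sqr_one_sub_fixpoint.
    by rewrite !(star_homB f_hom) (star_hom1 f_hom) !subKr (star_homM f_hom).
rewrite {}ym in y1.
have [|w [ww ws wz]] := sqrt_near_one y1; first by rewrite starB star1 ms.
have wh : (h * w = w * h)%cstar.
  apply: wz; rewrite cmulBl cmulBr cmul1x cmulx1 /m cmulZl cmulZr.
  by rewrite cmulBl cmulBr cmul1x cmulx1 cmulA.
pose k := (Num.sqrt s)^-1%:C *: w.
apply: (@norm_re_unitary _ _ h k) => //; first by rewrite starZr ws.
apply: selfadj_unitary; rewrite ?starZr ?ws//.
  by rewrite cmulZl cmulZr wh.
rewrite cmulZl cmulZr scalerA -rmorphM /= ww subKr /m scalerA -rmorphM /=.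
rewrite -invfM -expr2 sqr_sqrtr ?ltW// mulVf ?gt_eqF// rmorph1 scale1r.
by rewrite addrC subrK.
Qed.

Lemma injective_star_hom_isometric (a : A) : real_norm (f a) = real_norm a.
Proof.
apply/eqP; rewrite eq_le star_hom_contractive/= leNgt; apply/negP => fa.
pose p := real_norm (f a) ^+ 2; pose q := real_norm a ^+ 2; pose c := (p + q) / 2.
have pq : p < q by rewrite ltr_sqr ?nnegrE ?real_norm_ge0.
have p0 : 0 <= p by exact: sqr_ge0.
have [c0 pc cq] : [/\ 0 < c, p < c & c < q] by rewrite /c; split; lra.
have := @injective_star_hom_norm_le1 (c^-1%:C *: (a^* * a)%cstar).
rewrite starZr starM starK real_normZr (star_homZ f_hom) real_normZr.
rewrite (star_homM f_hom) (star_hom_star f_hom) !real_norm_cstar -/p -/q.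
have iv : 0 <= c^-1 by rewrite invr_ge0 ltW.
rewrite (ger0_norm iv) ltr_pdivrMl// mulr1 ler_pdivrMl// mulr1.
by move=> /(_ erefl pc); lra.
Qed.

End StarHomNorm.

(** * Averages by unitaries *)

Section Averages.
Variables (R : realType) (A : cstarAlgType R).
Implicit Types (w : seq (R * A)).

(** The coefficients and unitaries of an average are kept apart from the element that is
averaged, because the proof applies one family to several coefficients, each with its
own twist. *)
Definition averaging w : Prop :=
  {in w, forall p, 0 <= p.1 /\ unitaries p.2} /\ \sum_(p <- w) p.1 = 1.

Definition averaging_comp w1 w2 : seq (R * A) :=
  [seq (p.1 * q.1, (p.2 * q.2)%cstar) | p <- w1, q <- w2].

Lemma averaging_compP w1 w2 :
  averaging w1 -> averaging w2 -> averaging (averaging_comp w1 w2).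
Proof.
move=> [w1P w11] [w2P w21]; split=> [_ /allpairsP[[p q] /= [pw qw ->]]|].
  have [p0 pu] := w1P _ pw; have [q0 qu] := w2P _ qw.
  by split; [exact: mulr_ge0|exact: unitaryM].
rewrite big_allpairs_dep /= -[RHS]w11; apply: eq_bigr => p _.
by rewrite -mulr_sumr w21 mulr1.
Qed.

Lemma averaging1 : averaging [:: (1, 1%cstar)].
Proof.
split=> [p|]; last by rewrite big_seq1.
by rewrite inE => /eqP ->; split; [exact: ler01|exact: unitary1].
Qed.

Section TwistedAverage.
Variables (E : cstarAlgType R) (sigma tau : A -> E).
Implicit Types x y : E.

(** With [sigma] and [tau] both the identity, the identity and an automorphism, or both
the inclusion, these are the averages in the Dixmier property, the strong averaging
property and the relative Dixmier property. *)
Definition average w x : E :=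
  \sum_(p <- w) p.1%:C *: (sigma p.2 * x * (tau p.2)^*)%cstar.

Lemma averageD w : {morph average w : x y / x + y}.
Proof.
move=> x y; rewrite -big_split /=; apply: eq_bigr => p _.
by rewrite cmulDr cmulDl scalerDr.
Qed.

Lemma average0 w : average w 0 = 0.
Proof. by rewrite /average big1// => p _; rewrite cmulx0 cmul0x scaler0. Qed.

Lemma averageN w x : average w (- x) = - average w x.
Proof. by apply: (addrI (average w x)); rewrite -averageD !subrr average0. Qed.

Lemma averageB w : {morph average w : x y / x - y}.
Proof. by move=> x y; rewrite averageD averageN. Qed.

Lemma average_sum w (I : Type) (r : seq I) (F : I -> E) :
  average w (\sum_(i <- r) F i) = \sum_(i <- r) average w (F i).
Proof. by apply: (big_morph _ (averageD w) (average0 w)). Qed.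

Hypotheses (sigma_hom : star_hom sigma) (tau_hom : star_hom tau).

Lemma average_norm_le w x : averaging w -> real_norm (average w x) <= real_norm x.
Proof.
move=> [wP w1]; rewrite (le_trans (real_norm_sum _ _))//.
rewrite -[leRHS]mul1r -w1 mulr_suml big_seq [leRHS]big_seq.
apply: ler_sum => p /wP[p0 pu]; rewrite real_normZr ger0_norm// ler_wpM2l//.
by apply: real_norm_conj_le; [|apply: unitary_star]; exact: star_hom_unitary.
Qed.

Lemma average_comp w1 w2 x :
  average (averaging_comp w1 w2) x = average w1 (average w2 x).
Proof.
rewrite [LHS]big_allpairs_dep /= [RHS]/average; apply: eq_bigr => p _.
have sum_conj a b : (a * average w2 x * b)%cstar = \sum_(q <- w2)
    (a * (q.1%:C *: (sigma q.2 * x * (tau q.2)^*)%cstar) * b)%cstar.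
  apply: (@big_morph _ _ (fun z : E => (a * z * b)%cstar)) => [y z|].
    by rewrite cmulDr cmulDl.
  by rewrite cmulx0 cmul0x.
rewrite sum_conj scaler_sumr; apply: eq_bigr => q _.
rewrite cmulZr cmulZl scalerA -rmorphM (star_homM sigma_hom) (star_homM tau_hom) starM.
by rewrite !cmulA.
Qed.

Lemma convex_hull_averageP x z :
  convex_hull [set (sigma v * x * (tau v)^*)%cstar | v in @unitaries R A] z <->
  exists2 w, averaging w & z = average w x.
Proof.
split=> [[n [c [y [c0 c1 yP ->]]]]|[w [wP w1] ->]].
  have /choice[v vP] k : exists v : A,
      unitaries v /\ (sigma v * x * (tau v)^*)%cstar = y k.
    by have [v vu vy] := yP k; exists v.
  exists [seq (c k, v k) | k <- index_enum 'I_n].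
    split; last by rewrite big_map.
    by move=> _ /mapP[k _ ->] /=; split=> //; case: (vP k).
  by rewrite /average big_map; apply: eq_bigr => k _ /=; case: (vP k) => _ ->.
pose q k := nth (0, 1%cstar) w k.
have qP (k : 'I_(size w)) : 0 <= (q k).1 /\ unitaries (q k).2.
  exact/wP/mem_nth.
exists (size w), (fun k => (q k).1),
  (fun k => (sigma (q k).2 * x * (tau (q k).2)^*)%cstar); split.
- by move=> k; case: (qP k).
- by rewrite -w1 (big_nth (0, 1%cstar)) big_mkord.
- by move=> k; exists (q k).2 => //; case: (qP k).
- by rewrite /average (big_nth (0, 1%cstar)) big_mkord.
Qed.

Lemma closure_averageP x z :
  closure (convex_hull
    [set (sigma v * x * (tau v)^*)%cstar | v in @unitaries R A]) z <->
  forall e : R, 0 < e -> exists2 w, averaging w & real_norm (average w x - z) < e.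
Proof.
split=> [/closure_real_norm xz e /xz[_ /convex_hull_averageP[w wP ->]]|xz].
  by rewrite real_normB; exists w.
apply/closure_real_norm => e /xz[w wP we]; exists (average w x).
  by apply/convex_hull_averageP; exists w.
by rewrite real_normB.
Qed.

End TwistedAverage.

Lemma average_scalar (E : cstarAlgType R) (sigma : A -> E) w (c : R[i]) :
  star_hom sigma -> averaging w -> average sigma sigma w (c *: 1%cstar) = c *: 1%cstar.
Proof.
move=> sigma_hom [wP w1]; rewrite /average big_seq.
under eq_bigr => p /wP[_ /(star_hom_unitary sigma_hom)[_ pp]].
  rewrite cmulZr cmulx1 cmulZl pp; over.
by rewrite -big_seq -scaler_suml -rmorph_sum w1 scale1r.
Qed.

Lemma average_hom (B E : cstarAlgType R) (sigma tau : A -> B) (f : B -> E) w b :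
  star_hom f ->
  f (average sigma tau w b) = average (f \o sigma) (f \o tau) w (f b).
Proof.
move=> f_hom; rewrite /average (star_hom_sum f_hom); apply: eq_bigr => p _.
by rewrite (star_homZ f_hom) !(star_homM f_hom) (star_hom_star f_hom).
Qed.

End Averages.

(** * Coefficients in the reduced crossed product *)

Section SquareSummable.
Variables (R : realType) (G : choiceType) (H : hilbertType R).
Implicit Types (xi zeta : G -> H) (eta : H).

Definition delta_at (K : choiceType) (V : nmodType) (t : K) (v : V) : K -> V :=
  fun s => if s == t then v else 0.

Lemma l2_norm_delta_at (r : G) eta : l2_norm (delta_at r eta : G -> H) = (real_norm eta)%:E.
Proof.
rewrite /l2_norm.
rewrite [X in sqrte X](_ : _ = \esum_(s in [set r]) (real_norm eta ^+ 2)%:E).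
  by rewrite esum_set1 ?lee_fin ?sqr_ge0//= sqrtr_sqr ger0_norm ?real_norm_ge0.
rewrite [RHS]esum_mkcond; apply: eq_esum => s _.
rewrite /delta_at; case: (eqVneq s r) => [->|/eqP sr]; first by rewrite mem_set.
by rewrite memNset// real_norm0 expr0n.
Qed.

Lemma real_norm_le_l2_norm xi s : ((real_norm (xi s))%:E <= l2_norm xi)%E.
Proof.
have -> : (real_norm (xi s))%:E = sqrte (real_norm (xi s) ^+ 2)%:E.
  by rewrite /= sqrtr_sqr ger0_norm ?real_norm_ge0.
rewrite lee_sqrt; last by apply: esum_ge0 => t _; rewrite lee_fin sqr_ge0.
by apply: esum_ge; exists [set s]; [split|rewrite fsbig_set1].
Qed.

Lemma l2_norm_le (C : R) xi zeta : 0 <= C ->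
  (forall s, real_norm (zeta s) <= C * real_norm (xi s)) ->
  (l2_norm xi <= 1)%E -> (l2_norm zeta <= C%:E)%E.
Proof.
move=> C0 Cle.
have -> : 1%E = sqrte (1 : R)%:E by rewrite /= sqrtr1.
have -> : C%:E = sqrte (C ^+ 2)%:E by rewrite /= sqrtr_sqr ger0_norm.
rewrite !lee_sqrt ?lee_fin ?sqr_ge0 ?ler01// => xi1.
apply: ge_ereal_sup => _ [X [/finite_seqP[s ->] _] <-].
have /[dup] Xle : [set` s] = [set` undup s].
  by apply/seteqP; split=> t /=; rewrite mem_undup.
move=> ->; rewrite -fsbig_seq ?undup_uniq// sumEFin lee_fin.
apply: (@le_trans _ _ (\sum_(t <- undup s) C ^+ 2 * real_norm (xi t) ^+ 2)).
  apply: ler_sum => t _; rewrite -exprMn ler_sqr ?nnegrE ?mulr_ge0 ?real_norm_ge0//.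
rewrite -mulr_sumr ler_piMr ?sqr_ge0// -lee_fin (le_trans _ xi1)//.
apply: esum_ge; exists [set` undup s]; first by split.
by rewrite -fsbig_seq ?undup_uniq// sumEFin.
Qed.

End SquareSummable.

Section FinitelySupported.
Variables (G : choiceType) (V : nmodType).

(** An enumeration of the support in which the point [t0] comes first: below, [t0] is the
neutral element, whose coefficient is treated apart from the others. *)
Lemma finitely_supported_seq (f : G -> V) (t0 : G) : finitely_supported f ->
  exists s, [/\ uniq (t0 :: s), forall t, t \in s -> t <> t0
    & forall t, t \notin t0 :: s -> f t = 0].
Proof.
move=> /finite_seqP[s sE]; exists (rem t0 (undup s)).
have us := undup_uniq s; have mem := mem_rem_uniq _ us; split=> [||t].
- by rewrite /= rem_uniq// andbT mem inE eqxx.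
- by move=> t; rewrite mem inE => /andP[/eqP].
- rewrite in_cons mem !inE mem_undup negb_or negb_and negbK => /andP[/negPf ->] /= ts.
  apply/eqP/negPn/negP => ft; have : [set t | f t != 0] t by [].
  by rewrite sE /= (negPf ts).
Qed.

Lemma finitely_supported_delta_at (t : G) (v : V) : finitely_supported (delta_at t v).
Proof.
apply: (@sub_finite_set _ _ [set t]) => //= s; rewrite /delta_at /=.
by case: (eqVneq s t) => // _; rewrite eqxx.
Qed.

End FinitelySupported.

Lemma finitely_supportedB (G : choiceType) (V : zmodType) (f g : G -> V) :
  finitely_supported f -> finitely_supported g ->
  finitely_supported (fun t => f t - g t).
Proof.
move=> ff fg; have ffg : finite_set ([set t | f t != 0] `|` [set t | g t != 0]).
  by rewrite finite_setU.
apply: sub_finite_set ffg => t /=; case: (eqVneq (f t) 0) => [->|]; last by left.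
by rewrite sub0r oppr_eq0; right.
Qed.

Section CrossedSum.
Variables (R : realType) (G : groupType) (A D : cstarAlgType R).
Variables (alpha : G -> A -> A) (iota : A -> D) (u : G -> D).
Hypothesis iota_hom : star_hom iota.

Definition crossed_sum (f : G -> A) : D :=
  \sum_(t \in [set: G]) (iota (f t) * u t)%cstar.

Lemma crossed_sum_seq (f : G -> A) (s : seq G) : uniq s ->
  (forall t, t \notin s -> f t = 0) ->
  crossed_sum f = \sum_(t <- s) (iota (f t) * u t)%cstar.
Proof.
move=> us sf; rewrite /crossed_sum (fsbigE s)// => [|t _ /sf ->].
  by apply: eq_bigl => t; rewrite in_setT.
by rewrite (star_hom0 iota_hom) cmul0x.
Qed.

Lemma crossed_sum_delta_at t (a : A) :
  crossed_sum (delta_at t a) = (iota a * u t)%cstar.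
Proof.
rewrite (@crossed_sum_seq _ [:: t])// ?big_seq1 /delta_at ?eqxx// => s.
by rewrite inE => /negPf ->.
Qed.

Lemma crossed_sumB (f g : G -> A) : finitely_supported f -> finitely_supported g ->
  crossed_sum (fun t => f t - g t) = crossed_sum f - crossed_sum g.
Proof.
move=> /(@finitely_supported_seq _ _ _ 1%g)[s [us _ fs]].
move=> /(@finitely_supported_seq _ _ _ 1%g)[r [ur _ gr]].
pose q := undup ((1%g :: s) ++ (1%g :: r)).
have fq t : t \notin q -> f t = 0.
  by rewrite mem_undup mem_cat negb_or => /andP[/fs].
have gq t : t \notin q -> g t = 0.
  by rewrite mem_undup mem_cat negb_or => /andP[_ /gr].
have uq : uniq q by exact: undup_uniq.
rewrite (crossed_sum_seq uq) => [|t tq]; last by rewrite fq// gq// subrr.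
rewrite (crossed_sum_seq uq fq) (crossed_sum_seq uq gq) -sumrB.
by apply: eq_bigr => t _; rewrite (star_homB iota_hom) cmulBl.
Qed.

Variables (H : hilbertType R) (rho : A -> H -> H).
Hypothesis rho_rep : faithful_rep rho.

Lemma rep0l (eta : H) : rho 0 eta = 0.
Proof.
case: rho_rep => _ lr _ _ _; have := lr eta 1 0 0.
by rewrite !scale1r addr0 => h; apply: (addrI (rho 0 eta)); rewrite addr0 -h.
Qed.

Lemma repZ (a : A) (c : R[i]) (eta : H) : rho a (c *: eta) = c *: rho a eta.
Proof.
case: rho_rep => /(_ a)[lr _] _ _ _ _; have := lr 1 0 0.
rewrite !scale1r addr0 => /esym/eqP; rewrite -subr_eq0 addrK => /eqP r0.
by have := lr c eta 0; rewrite r0 !addr0.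
Qed.

Lemma rep0r (a : A) : rho a 0 = 0.
Proof. by rewrite -[X in rho a X](scale0r (0 : H)) repZ scale0r. Qed.

Lemma regular_rep_delta_at (f : G -> A) (r s : G) (eta : H) :
  regular_rep alpha rho f (delta_at r eta) s
  = rho (alpha s^-1%g (f (s * r^-1)%g)) eta.
Proof.
rewrite /regular_rep (fsbigE [:: (s * r^-1)%g])// => [|t _].
  rewrite big_mkcond big_seq1 in_setT /delta_at.
  by rewrite invgF mulgVK eqxx.
rewrite inE => tsr; rewrite /delta_at; case: eqP => [tr|_]; last by rewrite rep0r.
by move: tsr; rewrite -tr invgM invgK mulgA mulgV mul1g eqxx.
Qed.

Hypotheses (alpha_act : cstar_action alpha) (u1 : u 1%g = 1%cstar).
Hypothesis crossed_sum_norm : forall f, finitely_supported f ->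
  (real_norm (crossed_sum f))%:E = reduced_norm alpha rho f.

(** The vector [eta] placed at [t^-1 s] is moved to [s] by the summand of index [t]
alone. *)
Lemma rep_coefficient_le (f : G -> A) (s t : G) (eta : H) : finitely_supported f ->
  real_norm (rho (alpha s^-1%g (f t)) eta)
    <= real_norm (crossed_sum f) * real_norm eta.
Proof.
move=> ff; wlog eta1 : eta / real_norm eta = 1 => [wlog_eta|].
  have [eta0|eta0] := eqVneq (real_norm eta) 0.
    by rewrite (real_norm_eq0 eta0) rep0r !real_norm0 mulr0.
  have := wlog_eta ((real_norm eta)^-1%:C *: eta).
  rewrite repZ !real_normZr ger0_norm ?invr_ge0 ?real_norm_ge0// mulVf// mulr1.
  by move=> /(_ erefl); rewrite ler_pdivrMl 1?mulrC// lt_neqAle eq_sym eta0 real_norm_ge0.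
rewrite eta1 mulr1 -lee_fin crossed_sum_norm//.
pose xi := delta_at (t^-1 * s)%g eta.
apply: (@le_trans _ _ (l2_norm (regular_rep alpha rho f xi))).
  apply: le_trans (real_norm_le_l2_norm _ s).
  by rewrite regular_rep_delta_at invgM invgK mulVKg.
apply: ereal_sup_ubound; exists xi => //=.
by rewrite l2_norm_delta_at eta1.
Qed.

Lemma covariant_injective : injective iota.
Proof.
have iota0 a : iota a = 0 -> a = 0.
  move=> a0; case: rho_rep => _ _ _ _; apply; apply/funext => eta.
  rewrite rep0l; apply: real_norm_eq0; apply/eqP.
  rewrite eq_le real_norm_ge0 andbT.
  have := @rep_coefficient_le (delta_at 1%g a) 1%g 1%g eta (finitely_supported_delta_at _ _).
  rewrite crossed_sum_delta_at a0 cmul0x real_norm0 mul0r /delta_at eqxx.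
  by case: alpha_act => _ al1 _; rewrite invg1 al1.
by move=> a b ab; apply/subr0_eq/iota0; rewrite (star_homB iota_hom) ab subrr.
Qed.

Lemma covariant_isometric (a : A) : real_norm (iota a) = real_norm a.
Proof. exact: (injective_star_hom_isometric iota_hom covariant_injective). Qed.

(** [iota (f t)] acts on l^2(G, H) diagonally, with the blocks that
[rep_coefficient_le] bounds. *)
Lemma coefficient_norm_le (f : G -> A) (t : G) : finitely_supported f ->
  real_norm (f t) <= real_norm (crossed_sum f).
Proof.
move=> ff; rewrite -covariant_isometric.
rewrite -[iota _]cmulx1 -u1 -crossed_sum_delta_at -lee_fin.
rewrite crossed_sum_norm; last exact: finitely_supported_delta_at.
apply: ge_ereal_sup => _ [xi xi1 <-].
apply: (@l2_norm_le _ _ _ _ xi) xi1 => [|s]; first exact: real_norm_ge0.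
rewrite /regular_rep (fsbigE [:: 1%g])// => [|r _]; last first.
  rewrite inE /delta_at => /negPf ->; case: alpha_act => /(_ s^-1%g)[h _] _ _.
  by rewrite (star_hom0 h) rep0l.
rewrite big_mkcond big_seq1 in_setT /delta_at eqxx invg1 mul1g.
exact: rep_coefficient_le.
Qed.

End CrossedSum.

Section SimultaneousAveraging.
Variables (R : realType) (G : groupType) (A : cstarAlgType R) (alpha : G -> A -> A).
Hypothesis alpha_act : cstar_action alpha.

Lemma action_hom t : star_hom (alpha t).
Proof. by case: alpha_act => /(_ t)[]. Qed.

(** The group elements are treated one by one. Each new average acts on top of the
previous ones and is contractive for every twist, so the coefficients that are already
small remain so. *)
Lemma average_small (f : G -> A) (s : seq G) (w0 : seq (R * A)) (e : R) :
  (forall t, t \in s -> savep (alpha t)) -> averaging w0 -> 0 < e ->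
  exists2 w, averaging w & forall t, t \in s ->
    real_norm (average id (alpha t) (averaging_comp w w0) (f t)) < e.
Proof.
move=> + w0P e0; elim: s => [_|t s IH sP].
  by exists [:: (1, 1%cstar)] => //; exact: averaging1.
have [r rs|w1 w1P w1s] := IH; first by apply: sP; rewrite in_cons rs orbT.
have /(_ (mem_head _ _))/(_ (average id (alpha t) (averaging_comp w1 w0) (f t))) := sP t.
move=> /(closure_averageP id (alpha t))/(_ e e0)[w2 w2P].
rewrite subr0 => w2t.
exists (averaging_comp w2 w1); first exact: averaging_compP.
have assoc r x : average id (alpha r) (averaging_comp (averaging_comp w2 w1) w0) x
    = average id (alpha r) w2 (average id (alpha r) (averaging_comp w1 w0) x).
  by rewrite !(average_comp (star_hom_id A) (action_hom r)).
move=> r; rewrite in_cons assoc => /predU1P[->//|/w1s].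
move=> w1r; apply: le_lt_trans w1r.
by apply: (average_norm_le (star_hom_id A) (action_hom r)).
Qed.

End SimultaneousAveraging.

(** * Averaging in the reduced crossed product *)

Section ReducedCrossedProduct.
Variables (R : realType) (G : groupType) (A D : cstarAlgType R).
Variables (alpha : G -> A -> A) (iota : A -> D) (u : G -> D).
Hypotheses (alpha_act : cstar_action alpha)
  (crossed : is_reduced_crossed_product alpha iota u).
Local Notation cs := (crossed_sum iota u).

Lemma crossed_hom : star_hom iota. Proof. by case: crossed. Qed.

Lemma crossed_unitary t : unitaries (u t).
Proof. by case: crossed => _ [/(_ t)]. Qed.

Lemma crossed_u1 : u 1%g = 1%cstar.
Proof.
case: crossed => _ [uu um] _ _ _; have [u1 _] := uu 1%g.
by rewrite -[LHS]cmul1x -u1 -cmulA -um mulg1.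
Qed.

Lemma crossed_isometric a : real_norm (iota a) = real_norm a.
Proof.
case: crossed => _ _ _ [H [rho [rep norm]]] _.
exact: (covariant_isometric crossed_hom rep alpha_act norm).
Qed.

Lemma crossed_coefficient_le (f : G -> A) t : finitely_supported f ->
  real_norm (f t) <= real_norm (cs f).
Proof.
case: crossed => _ _ _ [H [rho [rep norm]]] _.
exact: (coefficient_norm_le crossed_hom rep alpha_act crossed_u1 norm).
Qed.

Lemma crossed_dense (x : D) (e : R) : 0 < e ->
  exists2 f, finitely_supported f & real_norm (x - cs f) < e.
Proof.
case: crossed => _ _ _ _ dense_cs.
by move=> /(dense_real_norm x dense_cs)[_ [f ff <-]]; exists f.
Qed.

Lemma crossed_covariance t a : (u t * iota a)%cstar = (iota (alpha t a) * u t)%cstar.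
Proof.
have [uu _] := crossed_unitary t.
by case: crossed => _ _ <- _ _; rewrite -cmulA uu cmulx1.
Qed.

(** Covariance carries [iota v^*] past [u t] and turns it into [iota (alpha t v)^*]. *)
Lemma average_crossed w b t : average iota iota w (iota b * u t)%cstar
  = (iota (average id (alpha t) w b) * u t)%cstar.
Proof.
have iH := crossed_hom.
rewrite /average (star_hom_sum iH).
rewrite (big_morph (fun z : D => (z * u t)%cstar) (fun y z => cmulDl y z (u t)) (cmul0x _)).
apply: eq_bigr => p _; rewrite (star_homZ iH) cmulZl !(star_homM iH).
rewrite -(star_hom_star (action_hom alpha_act t)) -[RHS]/(_ *: _) -!cmulA.
by rewrite -crossed_covariance (star_hom_star iH).
Qed.

(** The canonical conditional expectation at [x]: the coefficients at the neutral
element of finitely supported approximations of [x] converge. *)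
Lemma expectation_exists (x : D) : exists a : A, forall g, finitely_supported g ->
  real_norm (a - g 1%g) <= real_norm (x - cs g).
Proof.
have coefB f g : finitely_supported f -> finitely_supported g ->
    real_norm (f 1%g - g 1%g) <= real_norm (x - cs f) + real_norm (x - cs g).
  move=> ff gg; have fg := finitely_supportedB ff gg.
  rewrite (le_trans (crossed_coefficient_le 1%g fg))// crossed_sumB//; last exact: crossed_hom.
  by rewrite (real_normB x) real_norm_triangle.
have /choice[f fP] (n : nat) : exists f, finitely_supported f /\
    real_norm (x - cs f) < n.+1%:R^-1.
  by have [|f ff fx] := @crossed_dense x n.+1%:R^-1 => //; exists f.
have f_small (e : R) : 0 < e -> exists n0, forall n, (n0 <= n)%N ->
    real_norm (x - cs (f n)) < e.
  move=> e0; exists (Num.bound e^-1) => n n0n; apply: (lt_trans (fP n).2).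
  rewrite invf_plt ?posrE//.
  rewrite (lt_le_trans (archi_boundP _)) ?invr_ge0 ?(ltW e0)//.
  by rewrite ler_nat leqW.
have [|a fa] := @real_norm_cauchy _ _ (fun n => f n 1%g).
  move=> e e0; have [|n0 n0P] := f_small (e / 2); first by rewrite divr_gt0.
  exists n0 => m n /n0P mP /n0P nP.
  by have := coefB _ _ (fP m).1 (fP n).1 => ?; lra.
exists a => g gg; apply/ler_addgt0Pr => e e0.
have [|n1 n1P] := fa (e / 2); first by rewrite divr_gt0.
have [|n2 n2P] := f_small (e / 2); first by rewrite divr_gt0.
have := n1P _ (leq_maxl n1 n2); have := n2P _ (leq_maxr n1 n2).
set n := maxn _ _ => h2 h1; have := coefB _ _ (fP n).1 gg.
have := real_norm_triangle (f n 1%g) a (g 1%g).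
by rewrite (real_normB a (f n _)) => *; lra.
Qed.

Lemma relative_dixmier_imp_dixmier : relative_dixmier iota -> dixmier A.
Proof.
move=> rel x; have iH := crossed_hom.
have [z [/(closure_averageP iota iota) xc [c _ cE]]] := rel (iota x).
exists (c *: 1%cstar); split; last by exists c.
apply/(closure_averageP id id) => e /xc[w wP].
rewrite -cE -(average_hom id id w x iH) -(star_hom1 iH) -(star_homZ iH).
by rewrite -(star_homB iH) crossed_isometric; exists w.
Qed.

(** The coefficient at [t] of [iota b' u_t - c] is [b'], as [t] is not neutral. *)
Lemma relative_dixmier_imp_savep : relative_dixmier iota -> action_savep alpha.
Proof.
move=> rel t t1 b; have iH := crossed_hom.
have [z [/(closure_averageP iota iota) xc [c _ cE]]] := rel (iota b * u t)%cstar.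
apply/(closure_averageP id (alpha t)) => e /xc[w wP].
rewrite -cE average_crossed => we; exists w => //; rewrite subr0.
apply: le_lt_trans we; set b' := average _ _ _ _.
have fb : finitely_supported (delta_at t b') by exact: finitely_supported_delta_at.
have fc : finitely_supported (delta_at (1%g : G) (c *: (cone : A))).
  exact: finitely_supported_delta_at.
have := crossed_coefficient_le t (finitely_supportedB fb fc).
rewrite crossed_sumB// !crossed_sum_delta_at// crossed_u1 cmulx1.
rewrite (star_homZ iH) (star_hom1 iH) /delta_at eqxx.
by case: eqP => // _; rewrite subr0.
Qed.

(** The order of the averages matters: [w0] is chosen for the expectation [a] before the
off-diagonal coefficients are reduced, since the scalar obtained from [a] need not
belong to the averages of a further average of [a]. *)
Lemma dixmier_savep_imp_relative_dixmier :
  dixmier A -> action_savep alpha -> relative_dixmier iota.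
Proof.
move=> dix sav x; have iH := crossed_hom; have idH := star_hom_id A.
have [a xa] := expectation_exists x.
have [z [/(closure_averageP id id) ac [c _ cE]]] := dix a.
exists (c *: 1%cstar); split; last by exists c.
apply/(closure_averageP iota iota) => e e0.
have e4 : 0 < e / 4 by rewrite divr_gt0.
have [f ff xf] := crossed_dense x e4.
have [w0 w0P aw0] := ac _ e4.
have [s [us s1 fs]] := finitely_supported_seq 1%g ff.
(* The [size s] small coefficients must add up to at most [e / 4]. *)
pose d := e / 4 / (size s).+1%:R.
have d0 : 0 < d by rewrite divr_gt0.
have [t /s1 t1|w1 w1P w1s] := average_small alpha_act f (s := s) _ w0P d0.
  exact: sav.
pose w := averaging_comp w1 w0; have wP : averaging w := averaging_compP w1P w0P.
exists w => //.
have tail : real_norm (average iota iota w (\sum_(t <- s) (iota (f t) * u t)%cstar))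
    <= e / 4.
  rewrite average_sum (le_trans (real_norm_sum _ _))//.
  apply: (@le_trans _ _ (\sum_(t <- s) d)).
    rewrite big_seq [leRHS]big_seq; apply: ler_sum => t /w1s /ltW td.
    rewrite average_crossed (le_trans _ td)// (le_trans (real_normM _ _))//.
    rewrite crossed_isometric ler_piMr ?real_norm_ge0//.
    exact/unitary_norm/crossed_unitary.
  rewrite big_const_seq count_predT iter_addr_0 -[d *+ _]mulr_natr -(mulrA (e / 4)).
  rewrite (ler_piMr (ltW e4))//.
  by rewrite mulrC ler_pdivrMr// mul1r ler_nat.
have head : real_norm (average iota iota w (iota (f 1%g) * u 1%g)%cstar - c *: 1%cstar)
    < e / 4 + e / 4.
  rewrite crossed_u1 cmulx1 -(average_hom id id w (f 1%g) iH).
  rewrite -(star_hom1 iH) -(star_homZ iH) -(star_homB iH) crossed_isometric.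
  rewrite (average_comp idH idH) -(average_scalar c idH w1P) -averageB.
  rewrite (le_lt_trans (average_norm_le idH idH _ w1P))//.
  rewrite (le_lt_trans (real_norm_triangle (average id id w0 a) _ _))//.
  rewrite ler_ltD//; last by rewrite cE.
  rewrite -averageB (le_trans (average_norm_le idH idH _ w0P))// real_normB.
  exact: le_trans (xa _ ff) (ltW xf).
have cs_f : average iota iota w (cs f)
    = average iota iota w (iota (f 1%g) * u 1%g)%cstar
      + average iota iota w (\sum_(t <- s) (iota (f t) * u t)%cstar).
  by rewrite (crossed_sum_seq u iH us fs) big_cons averageD.
rewrite -[x](subrK (cs f)) averageD cs_f.
have := average_norm_le iH iH (x - cs f) wP.
set y := average _ _ _ (x - cs f); set p := average _ _ _ _ in head *.
set q := average _ _ _ _ in tail *; set k := c *: 1%cstar in head *.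
rewrite [p + q]addrC (addrA y) -(addrA (y + q)) => xy.
have := real_normD (y + q) (p - k); have := real_normD y q => *; lra.
Qed.

End ReducedCrossedProduct.

Theorem corollary3p3 (R : realType) (G : groupType) (A : cstarAlgType R)
    (alpha : G -> A -> A) (D : cstarAlgType R) (iota : A -> D) (u : G -> D)
    (Halpha : cstar_action alpha)
    (HD : is_reduced_crossed_product alpha iota u) :
  relative_dixmier iota <-> (dixmier A /\ action_savep alpha).
Proof.
split=> [rel|[dix sav]]; last exact: dixmier_savep_imp_relative_dixmier HD dix sav.
split; first exact: relative_dixmier_imp_dixmier HD rel.
exact: relative_dixmier_imp_savep HD rel.
Qed.
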